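(* Let $G(t)=(\mathcal N,\mathcal E(t))$, $t=0,1,2,\ldots$, be a sequence of symmetric graphs on $\mathcal N=\{1,\ldots,n\}$ for which there is a positive integer $B$ such that, for every integer $k\ge0$, the graph $\big(\mathcal N,\mathcal E(kB)\cup\mathcal E(kB+1)\cup\cdots\cup\mathcal E((k+1)B-1)\big)$ is strongly connected. Then, for every initial vector $x(0)\in\mathbb R^n$, the values generated by the load-balancing averaging algorithm (described in the context) satisfy $$\lim_{t\to\infty}x_i(t)=\frac1n\sum_{k=1}^n x_k(0)\qquad\text{for all }i.$$
   Context: A graph is symmetric if $(i,j)\in\mathcal E(t)$ iff $(j,i)\in\mathcal E(t)$. Let $\mathcal N_i(t)=\{j\ne i:(i,j)\in\mathcal E(t)\}$ be the set of neighbors of $i$ at time $t$ ($i$ itself excluded). Load-balancing averaging algorithm. Each node $i$ holds a value $x_i(t)$ at the beginning of step $t$. At each time $t$, all nodes act simultaneously as follows. If $\mathcal N_i(t)$ is empty, node $i$ does nothing. Otherwise: 1. Node $i$ broadcasts its current value $x_i(t)$ to all its neighbors. 2. Node $i$ finds a neighbor $j\in\mathcal N_i(t)$ with the smallest value (ties broken arbitrarily). If $x_i(t)\le x_j(t)$, it makes no offer. If $x_j(t)<x_i(t)$, it makes an offer of size $(x_i(t)-x_j(t))/2$ to node $j$. 3. If node $i$ receives at least one offer, it accepts a largest one (ties broken arbitrarily), rejects all the others, and adds the value of the accepted offer to its own value. 4. If the offer made by node $i$ (if any) is accepted, node $i$ subtracts the value of that offer from its own value. The value of node $i$ after these steps is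 $x_i(t+1)$ (so $x_i(t+1)$ equals $x_i(t)$ plus the accepted incoming offer, if any, minus its own outgoing offer, if accepted). *)

(* Defs.v *)
From HB Require Import structures.
From mathcomp Require Import all_boot all_order all_algebra.
From mathcomp Require Import all_classical all_reals all_analysis.

Set Implicit Arguments.
Unset Strict Implicit.
Unset Printing Implicit Defensive.

Import Order.TTheory GRing.Theory Num.Theory.
Import numFieldNormedType.Exports.

Local Open Scope ring_scope.

Section Graphs.
Variable n : nat.

(* Self-loops are allowed in e; they play no role in neighbor sets. *)
Definition neighbor (e : rel 'I_n) (i j : 'I_n) : bool := (j != i) && e i j.

Definition strongly_connected (e : rel 'I_n) : Prop :=
  forall i j : 'I_n, connect e i j.

(* Edges (kB) `|` ... `|` Edges ((k+1)B - 1). *)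
Definition window_union (E : nat -> rel 'I_n) (B k : nat) : rel 'I_n :=
  fun i j => [exists s : 'I_B, E (k * B + s)%N i j].

End Graphs.

Section LoadBalancing.
Variables (R : realType) (n : nat).
Implicit Types (e : rel 'I_n) (x y : 'I_n -> R).

Definition smallest_neighbor e x (i j : 'I_n) : Prop :=
  neighbor e i j /\ forall k, neighbor e i k -> x j <= x k.

Definition offer_size x (i j : 'I_n) : R := (x i - x j) / 2.

(* offer i = Some j: node i makes an offer to j; offer i = None: it makes no
   offer, either because it has no neighbor or because the smallest-valued
   neighbor it found is not strictly below it. *)
Definition offers_ok e x (offer : 'I_n -> option 'I_n) : Prop :=
  forall i, match offer i with
            | Some j => smallest_neighbor e x i j /\ x j < x i
            | None => (forall j, ~~ neighbor e i j) \/
                      (exists2 j, smallest_neighbor e x i j & x i <= x j)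
            end.

(* accept i = Some j: node i accepts the offer made by j; accept i = None:
   node i received no offer. *)
Definition accepts_ok x (offer accept : 'I_n -> option 'I_n) : Prop :=
  forall i, match accept i with
            | Some j => offer j = Some i /\
                        (forall k, offer k = Some i ->
                                   offer_size x k i <= offer_size x j i)
            | None => forall k, offer k <> Some i
            end.

Definition incoming x (accept : 'I_n -> option 'I_n) (i : 'I_n) : R :=
  if accept i is Some j then offer_size x j i else 0.

Definition outgoing x (offer accept : 'I_n -> option 'I_n) (i : 'I_n) : R :=
  if offer i is Some j then
    (if accept j == Some i then offer_size x i j else 0)
  else 0.

(* A relation, not a function: ties are resolved by an arbitrary choice of
   offer and accept, which may change from one step to the next. *)
Definition balancing_step e x y : Prop :=
  exists offer accept : 'I_n -> option 'I_n,
    [/\ offers_ok e x offer,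
        accepts_ok x offer accept &
        forall i, y i = x i + incoming x accept i - outgoing x offer accept i].

Definition balancing_run (E : nat -> rel 'I_n) (x : nat -> 'I_n -> R) : Prop :=
  forall t, balancing_step (E t) (x t) (x t.+1).

End LoadBalancing.

(* Main.v *)
Require Import Defs.
From HB Require Import structures.
From mathcomp Require Import all_boot all_order all_algebra.
From mathcomp Require Import all_classical all_reals all_analysis.
From mathcomp Require Import ring lra.

Set Implicit Arguments.
Unset Strict Implicit.
Unset Printing Implicit Defensive.

Import Order.TTheory GRing.Theory Num.Theory.
Import numFieldNormedType.Exports.

Local Open Scope classical_set_scope.
Local Open Scope ring_scope.

(** The potential is the sum of squares of the values.  An accepted offer of
    size [s] goes from a node to one lying [2 * s] lower.  As every node takes
    part in at most one incoming and one outgoing transfer, both nonnegative,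
    the squares of the displacements add up to at most twice the sum of the
    [s ^+ 2], while the first-order term is minus four times that sum; the
    potential thus drops by at least twice the sum of the squares of the
    accepted offers ([energy_decrease]).  Being nonincreasing and nonnegative,
    it converges, so its one-step drop tends to zero, and with it the largest
    accepted offer.

    The largest accepted offer controls everything else.  A node that makes an
    offer addresses its lowest neighbor, and that neighbor accepts an offer at
    least as large; so no node exceeds any of its neighbors by more than twice
    the largest accepted offer, and by symmetry of the graph neighbors are
    within that distance of each other ([neighbor_gap]).  No value moves by
    more than the largest accepted offer either ([step_drift]).

    Hence, once all offers are small, values hardly move during a window of
    [B] steps, and two nodes joined by an edge at some time of the window are
    close at the start of the window.  A path in the connected union of the
    window then shows that all nodes are close to each other
    ([window_agreement]).  Since each transfer preserves the sum, the common
    limit can only be the initial average. *)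

(** * One balancing step *)

Definition energy (R : realType) (n : nat) (x : 'I_n -> R) : R :=
  \sum_i x i ^+ 2.

Section Step.
Variables (R : realType) (n : nat) (e : rel 'I_n) (x y : 'I_n -> R).
Variables (offer accept : 'I_n -> option 'I_n).
Hypothesis e_sym : symmetric e.
Hypothesis offerP : offers_ok e x offer.
Hypothesis acceptP : accepts_ok x offer accept.
Hypothesis stepP :
  forall i, y i = x i + incoming x accept i - outgoing x offer accept i.

(** The accepted offers can be enumerated by receiver or by sender, because a
    node accepts at most one offer and makes at most one. *)
Lemma receiver_sum_eq_sender_sum (F : 'I_n -> 'I_n -> R) :
  \sum_i (if accept i is Some j then F j i else 0) =
  \sum_j (if offer j is Some i then
            (if accept i == Some j then F j i else 0) else 0).
Proof.
have -> : \sum_i (if accept i is Some j then F j i else 0) =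
    \sum_i \sum_j (if accept i == Some j then F j i else 0).
  apply: eq_bigr => i _; case Ei: (accept i) => [j|].
    rewrite (bigD1 j) //= eqxx big1 ?addr0 // => k kj.
    by rewrite eq_sym (inj_eq (@Some_inj _)) (negbTE kj).
  by rewrite big1.
rewrite exchange_big; apply: eq_bigr => j _.
have off i : accept i = Some j -> offer j = Some i.
  by move=> Ei; have := acceptP i; rewrite Ei => -[].
case Ej: (offer j) => [i|].
  rewrite (bigD1 i) //= big1 ?addr0 // => k ki.
  case: eqP => // /off; rewrite Ej => -[ik].
  by rewrite ik eqxx in ki.
rewrite big1 // => i _; case: eqP => // /off.
by rewrite Ej.
Qed.

Lemma step_sum : \sum_i y i = \sum_i x i.
Proof.
under eq_bigr do rewrite stepP.
rewrite sumrB big_split /=.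
have := receiver_sum_eq_sender_sum (offer_size x).
by rewrite /incoming /outgoing => ->; rewrite addrK.
Qed.

Lemma offer_size_gt0 i j : offer i = Some j -> 0 < offer_size x i j.
Proof.
move=> Ei; have := offerP i; rewrite Ei => -[_ lt_ji].
by rewrite /offer_size; lra.
Qed.

Lemma incoming_ge0 i : 0 <= incoming x accept i.
Proof.
rewrite /incoming; case Ei: (accept i) => [j|] //.
have := acceptP i; rewrite Ei => -[oj _].
exact/ltW/offer_size_gt0.
Qed.

Lemma outgoing_ge0 i : 0 <= outgoing x offer accept i.
Proof.
rewrite /outgoing; case Ei: (offer i) => [j|] //.
by case: ifP => // _; exact/ltW/offer_size_gt0.
Qed.

(** Receivers accept a largest offer, so an offer is dominated by what its
    addressee accepts, even when it is itself rejected. *)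
Lemma offer_le_incoming i j :
  offer i = Some j -> offer_size x i j <= incoming x accept j.
Proof.
move=> Ei; have := acceptP j; rewrite /incoming.
by case: (accept j) => [k [_ /(_ _ Ei)]|/(_ _ Ei)].
Qed.

Lemma energy_decrease :
  2 * \sum_i incoming x accept i ^+ 2 <= energy x - energy y.
Proof.
pose s := offer_size x.
have inM (g : 'I_n -> R) : \sum_i g i * incoming x accept i =
    \sum_i (if accept i is Some j then g i * s j i else 0).
  apply: eq_bigr => i _; rewrite /incoming.
  by case: (accept i) => [j|] //; rewrite mulr0.
have outM (g : 'I_n -> R) : \sum_i g i * outgoing x offer accept i =
    \sum_i (if accept i is Some j then g j * s j i else 0).
  rewrite (receiver_sum_eq_sender_sum (fun j i => g j * s j i)).
  apply: eq_bigr => i _; rewrite /outgoing.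
  by case: (offer i) => [j|]; [case: ifP|]; rewrite ?mulr0.
have in2 : \sum_i incoming x accept i ^+ 2 =
    \sum_i (if accept i is Some j then s j i ^+ 2 else 0).
  apply: eq_bigr => i _; rewrite /incoming.
  by case: (accept i) => [j|] //; rewrite expr0n.
have out2 : \sum_i outgoing x offer accept i ^+ 2 =
    \sum_i incoming x accept i ^+ 2.
  rewrite in2 (receiver_sum_eq_sender_sum (fun j i => s j i ^+ 2)).
  apply: eq_bigr => i _; rewrite /outgoing.
  by case: (offer i) => [j|]; [case: ifP|]; rewrite ?expr0n.
(* A transfer of size s moves value down a gap of 2 s. *)
have first_order : \sum_i x i * outgoing x offer accept i -
    \sum_i x i * incoming x accept i = 2 * \sum_i incoming x accept i ^+ 2.
  rewrite inM outM in2 mulr_sumr -sumrB; apply: eq_bigr => i _.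
  by case: (accept i) => [j|]; rewrite ?subr0 ?mulr0 // /s /offer_size; field.
(* The cross term - 2 * incoming * outgoing of the squared displacement is
   nonpositive and is dropped. *)
have le_y : energy y <= \sum_i (x i ^+ 2
      + 2 * (x i * incoming x accept i)
      - 2 * (x i * outgoing x offer accept i)
      + incoming x accept i ^+ 2 + outgoing x offer accept i ^+ 2).
  apply: ler_sum => i _; rewrite stepP.
  have := mulr_ge0 (incoming_ge0 i) (outgoing_ge0 i).
  by nra.
move: le_y; rewrite !big_split /= sumrN -!mulr_sumr out2 -/(energy x).
by lra.
Qed.

Variable eps : R.
Hypothesis eps_ge0 : 0 <= eps.
Hypothesis energy_drop : energy x - energy y <= 2 * eps ^+ 2.

Lemma incoming_le i : incoming x accept i <= eps.
Proof.
have le_sum : incoming x accept i ^+ 2 <= \sum_k incoming x accept k ^+ 2.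
  by rewrite (bigD1 i) //= lerDl sumr_ge0 // => k _; exact: sqr_ge0.
rewrite -ler_sqr ?nnegrE ?incoming_ge0 //.
by have := energy_decrease; have := energy_drop; lra.
Qed.

Lemma step_drift i : `|y i - x i| <= eps.
Proof.
have out_le : outgoing x offer accept i <= eps.
  rewrite /outgoing; case Ei: (offer i) => [j|] //; case: ifP => // _.
  exact: le_trans (offer_le_incoming Ei) (incoming_le j).
have := incoming_le i; have := incoming_ge0 i; have := outgoing_ge0 i.
by rewrite stepP ler_norml => *; apply/andP; split; lra.
Qed.

Lemma neighbor_descent i j : neighbor e i j -> x i - x j <= 2 * eps.
Proof.
move=> nij; have := offerP i; case Ei: (offer i) => [k|].
  case=> -[_ /(_ _ nij) le_kj] _.
  have := le_trans (offer_le_incoming Ei) (incoming_le k).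
  by rewrite /offer_size; lra.
case=> [/(_ j)|[k [_ /(_ _ nij) le_kj] le_ik]]; first by rewrite nij.
by have := eps_ge0; lra.
Qed.

Lemma neighbor_gap i j : e i j -> `|x i - x j| <= 2 * eps.
Proof.
move=> eij; have [->|ne_ij] := eqVneq i j; first by rewrite subrr normr0 mulr_ge0.
have nij : neighbor e i j by rewrite /neighbor eq_sym ne_ij.
have nji : neighbor e j i by rewrite /neighbor ne_ij e_sym.
have := neighbor_descent nij; have := neighbor_descent nji.
by rewrite ler_norml => *; apply/andP; split; lra.
Qed.

End Step.

(** * From small offers to agreement over a window *)

Lemma path_gap (R : realType) (n : nat) (e : rel 'I_n) (f : 'I_n -> R) (c : R) :
  (forall i j, e i j -> `|f i - f j| <= c) ->
  forall p i, path e i p -> `|f i - f (last i p)| <= (size p)%:R * c.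
Proof.
move=> gap; elim=> [|j p IHp] i /=; first by rewrite subrr normr0 mul0r.
case/andP=> eij ejp; apply: le_trans (ler_distD (f j) _ _) _.
by rewrite -natr1 mulrDl mul1r addrC lerD ?IHp ?gap.
Qed.

(** Removing the loops from a path leaves fewer than [n] edges, which makes the
    bound independent of the path. *)
Lemma connected_gap (R : realType) (n : nat) (e : rel 'I_n) (f : 'I_n -> R)
    (c : R) : 0 <= c ->
  (forall i j, e i j -> `|f i - f j| <= c) ->
  strongly_connected e -> forall i j, `|f i - f j| <= n%:R * c.
Proof.
move=> c_ge0 gap conn i j; have /connectP[p ep ->] := conn i j.
case/shortenP: ep => q eq uq _; apply: le_trans (path_gap gap eq) _.
rewrite ler_wpM2r // ler_nat -[leqRHS]card_ord ltnW //.
by rewrite -[_.+1]/(size (i :: q)) -(card_uniqP uq) max_card.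
Qed.

Lemma drift_le (R : realType) (u : nat -> R) (T : nat) (eps : R) :
  (forall t, (T <= t)%N -> `|u t.+1 - u t| <= eps) ->
  forall r, `|u (T + r)%N - u T| <= r%:R * eps.
Proof.
move=> drift; elim=> [|r IHr]; first by rewrite addn0 subrr normr0 mul0r.
rewrite addnS -natr1 mulrDl mul1r [leRHS]addrC.
apply: (le_trans (ler_distD (u (T + r)%N) _ _)).
by rewrite lerD ?drift ?leq_addr.
Qed.

(** Two nodes joined by an edge at some time of the window [T = k * B, ...]
    differ by [2 * eps] then, hence by at most [2 * eps + 2 * B * eps] at time
    [T]; connectivity multiplies this by at most [n], and any later time of the
    window costs one more drift at each of the two ends. *)
Lemma window_agreement (R : realType) (n : nat) (E : nat -> rel 'I_n)
    (B N : nat) (x : nat -> 'I_n -> R) (eps : R) :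
  (0 < B)%N -> 0 <= eps ->
  (forall k, strongly_connected (window_union E B k)) ->
  (forall t, (N <= t)%N -> forall i, `|x t.+1 i - x t i| <= eps) ->
  (forall t, (N <= t)%N -> forall i j, E t i j ->
     `|x t i - x t j| <= 2 * eps) ->
  forall t, (N + B <= t)%N -> forall i j,
    `|x t i - x t j| <= (n%:R * (2 + 2 * B%:R) + 2 * B%:R) * eps.
Proof.
move=> B_gt0 eps_ge0 conn drift gap t le_t i j.
pose k := (t %/ B)%N; pose T := (k * B)%N.
have le_NT : (N <= T)%N.
  rewrite /T /k -(leq_add2r B) (leq_trans le_t) // {1}(divn_eq t B).
  by rewrite leq_add2l ltnW // ltn_mod.
have window_drift r a : (r <= B)%N -> `|x (T + r)%N a - x T a| <= B%:R * eps.
  move=> le_rB; apply: (@le_trans _ _ (r%:R * eps)).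
    apply: (@drift_le _ (x ^~ a)) => s le_Ts.
    exact/drift/(leq_trans le_NT).
  by rewrite ler_wpM2r // ler_nat.
have agree_T : `|x T i - x T j| <= n%:R * ((2 + 2 * B%:R) * eps).
  apply: connected_gap (conn k) i j => [|a b /existsP[s Eab]].
    by rewrite mulr_ge0 // addr_ge0 // mulr_ge0.
  have := gap _ (leq_trans le_NT (leq_addr s _)) _ _ Eab.
  have := window_drift s a (ltnW (ltn_ord s)).
  have := window_drift s b (ltnW (ltn_ord s)).
  rewrite !ler_norml => /andP[? ?] /andP[? ?] /andP[? ?].
  by apply/andP; split; lra.
have -> : t = (T + t %% B)%N by rewrite -divn_eq.
have le_rB : (t %% B <= B)%N by rewrite ltnW // ltn_mod.
move: agree_T (window_drift _ i le_rB) (window_drift _ j le_rB).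
rewrite !ler_norml => /andP[? ?] /andP[? ?] /andP[? ?].
by apply/andP; split; lra.
Qed.

(** * Convergence to the average *)

Lemma dist_mean_le (R : realType) (n : nat) (f : 'I_n -> R) (c : R) (i : 'I_n) :
  (forall k, `|f i - f k| <= c) -> `|(\sum_k f k) / n%:R - f i| <= c.
Proof.
move=> gap; have n_gt0 : 0 < n%:R :> R by rewrite ltr0n (leq_trans _ (ltn_ord i)).
have -> : (\sum_k f k) / n%:R - f i = (\sum_k (f k - f i)) / n%:R.
  rewrite sumrB sumr_const card_ord mulrBl -[f i *+ n]mulr_natr mulfK //.
  by rewrite gt_eqF.
rewrite normrM normfV (gtr0_norm n_gt0) ler_pdivrMr //.
apply: le_trans (ler_norm_sum _ _ _) _.
rewrite mulr_natr -[n in c *+ n]card_ord -sumr_const.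
by apply: ler_sum => k _; rewrite distrC.
Qed.

Lemma drop_cvg0 (R : realType) (u : nat -> R) :
  (forall t, u t.+1 <= u t) -> (forall t, 0 <= u t) ->
  (fun t => u t - u t.+1) @ \oo --> 0.
Proof.
move=> u_dec u_ge0; have cu : cvgn u.
  apply: nonincreasing_is_cvgn; first exact/nonincreasing_seqP.
  by exists 0 => _ [t _ <-].
rewrite -(subrr (limn u)); apply: cvgB => //.
by rewrite (cvg_shiftS u).
Qed.

Theorem theorem8p3 (R : realType) (n : nat) (E : nat -> rel 'I_n) (B : nat)
    (E_sym : forall t : nat, symmetric (E t))
    (B_gt0 : (0 < B)%N)
    (E_conn : forall k : nat, strongly_connected (window_union E B k))
    (x0 : 'I_n -> R) (x : nat -> 'I_n -> R)
    (x_init : x 0%N = x0)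
    (x_run : balancing_run E x) :
  forall i : 'I_n,
    (fun t : nat => x t i) @ \oo --> (\sum_(k < n) x0 k) / n%:R.
Proof.
move=> i.
have sum_x t : \sum_k x t k = \sum_k x0 k.
  elim: t => [|t <-]; first by rewrite x_init.
  by have [off [acc [_ accP stP]]] := x_run t; exact: step_sum accP stP.
have energy_ge0 t : 0 <= energy (x t).
  by apply: sumr_ge0 => k _; exact: sqr_ge0.
have energy_le t : energy (x t.+1) <= energy (x t).
  have [off [acc [offP accP stP]]] := x_run t.
  rewrite -subr_ge0; apply: le_trans (energy_decrease offP accP stP).
  by rewrite mulr_ge0 // sumr_ge0 // => k _; exact: sqr_ge0.
pose C : R := n%:R * (2 + 2 * B%:R) + 2 * B%:R.
have C_gt0 : 0 < C.
  by rewrite ltr_wpDl ?mulr_gt0 ?mulr_ge0 ?addr_ge0 ?mulr_ge0 ?ltr0n.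
apply/cvgrPdist_le => eta eta_gt0.
pose eps : R := eta / C.
have eps_gt0 : 0 < eps by rewrite divr_gt0.
have drop_gt0 : 0 < 2 * eps ^+ 2 by rewrite mulr_gt0 // exprn_gt0.
have [N _ small] := (cvgrPdist_le _ _).1 (drop_cvg0 energy_le energy_ge0)
  _ drop_gt0.
have drop t : (N <= t)%N -> energy (x t) - energy (x t.+1) <= 2 * eps ^+ 2.
  by move=> /small /=; rewrite sub0r normrN; apply: le_trans (ler_norm _).
exists (N + B)%N => // t le_t /=; rewrite -(sum_x t).
apply: dist_mean_le => k.
have -> : eta = C * eps by rewrite mulrC divfK // gt_eqF.
apply: window_agreement (ltW eps_gt0) E_conn _ _ t le_t i k => //.
  move=> s /drop le_s a; have [off [acc [offP accP stP]]] := x_run s.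
  exact: (step_drift offP accP stP (ltW eps_gt0) le_s).
move=> s /drop le_s a b; have [off [acc [offP accP stP]]] := x_run s.
exact: (neighbor_gap (E_sym s) offP accP stP (ltW eps_gt0) le_s).
Qed.
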